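(* Let $X,Y,Z,W$ be real-valued random variables with finite second moments and $U$ a (latent) random variable on the same probability space, satisfying the confounding bridge and completeness assumptions (A1) and (A2) given in the context, with confounding bridge functions $h_0$ and $g_0$. Suppose in addition that $(X,Y,Z,W)$ follows a multivariate elliptical distribution, i.e. its characteristic function is $\phi_{(X,Y,Z,W)}(\boldsymbol t)=e^{i\boldsymbol t^{\top}\boldsymbol\mu}\,\psi(\boldsymbol t^{\top}\boldsymbol\Sigma\boldsymbol t)$ for all $\boldsymbol t\in\mathbb R^4$, with a location parameter $\boldsymbol\mu\in\mathbb R^4$, a positive-definite scale matrix $\boldsymbol\Sigma$ and a univariate function $\psi$. Then the confounding bridge functions $g_0(z)$ and $h_0(w)$ are linear in $z$ and $w$, respectively (linear with an intercept allowed, and up to almost sure equality). Furthermore, in this case the generalized tetrad constraint $$E(Y\mid X)=E\{h_0(W)\mid X\}=E\{g_0(Z)\mid X\}\quad\text{almost surely}$$ and the classical tetrad constraint $$\sigma_{XY}\sigma_{ZW}=\sigma_{XZ}\sigma_{YW}=\sigma_{XW}\sigma_{YZ}$$ are equivalent.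
   Context: $\sigma_{AB}$ denotes the covariance of random variables $A$ and $B$. (A1) (Confounding bridge) (i) $E\{h_0(W)^2\}<\infty$ and $E(Y\mid U,Z=z)=E\{h_0(W)\mid U,Z=z\}$ for all $z$; (ii) $E\{g_0(Z)^2\}<\infty$ and $E(Y\mid U,W=w)=E\{g_0(Z)\mid U,W=w\}$ for all $w$. (Understood as almost sure identities of conditional expectations given $(U,Z)$ and given $(U,W)$.) (A2) (Completeness) (i) for any square-integrable function $l$, $E\{l(W)\mid Z\}=0$ almost surely if and only if $l(W)=0$ almost surely; (ii) for any square-integrable function $l$, $E\{l(Z)\mid W\}=0$ almost surely if and only if $l(Z)=0$ almost surely. *)

(* Defs.v *)
From HB Require Import structures.
From mathcomp Require Import all_boot all_order all_algebra.
From mathcomp Require Import all_classical all_reals all_analysis.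
From mathcomp Require Import complex.

Set Implicit Arguments.
Unset Strict Implicit.
Unset Printing Implicit Defensive.

Import Order.TTheory GRing.Theory Num.Theory.
Import numFieldNormedType.Exports.

Local Open Scope classical_set_scope.
Local Open Scope ring_scope.
Local Open Scope complex_scope.

Section conditional_expectation.
Context (R : realType) (d dV : measure_display) (T : measurableType d)
  (TV : measurableType dV) (P : probability T R).

(* [C] is a version of [E(A | V)]: it is measurable for the sigma-algebra
   generated by the random element [V], and it has the same integral as [A]
   on every event of that sigma-algebra. *)
Definition is_cond_exp (V : T -> TV) (A C : T -> R) : Prop :=
  [/\ P.-integrable [set: T] (EFin \o A),
      P.-integrable [set: T] (EFin \o C),
      measurable_fun [set: g_sigma_algebra_preimageType V] C &
      forall B : set T, g_sigma_algebra_preimage V B ->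
        (\int[P]_(w in B) (C w)%:E = \int[P]_(w in B) (A w)%:E)%E].

(* [E(A | V) = E(A' | V)] almost surely. Versions of a conditional expectation
   are unique up to almost sure equality, and they exist for integrable
   variables, so this amounts to having a version in common. *)
Definition cond_exp_eq (V : T -> TV) (A A' : T -> R) : Prop :=
  exists C : T -> R, is_cond_exp V A C /\ is_cond_exp V A' C.

End conditional_expectation.

Section elliptical_distribution.
Context (R : realType) (d : measure_display) (T : measurableType d)
  (P : probability T R) (n : nat).

Definition dot (u v : 'cV[R]_n) : R := (u^T *m v) 0 0.

Definition quad (S : 'M[R]_n) (t : 'cV[R]_n) : R := (t^T *m S *m t) 0 0.

Definition posdef (S : 'M[R]_n) : Prop :=
  S^T = S /\ forall t : 'cV[R]_n, t != 0 -> 0 < quad S t.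

Definition expi (x : R) : R[i] := cos x +i* sin x.

(* [E(exp(i t.V))], the expectation of a complex variable being taken on its
   real and imaginary parts. *)
Definition char_fun (V : T -> 'cV[R]_n) (t : 'cV[R]_n) : R[i] :=
  fine 'E_P[fun w => cos (dot t (V w))] +i*
  fine 'E_P[fun w => sin (dot t (V w))].

Definition elliptical (V : T -> 'cV[R]_n) : Prop :=
  exists (mu : 'cV[R]_n) (Sigma : 'M[R]_n) (psi : R -> R[i]),
    posdef Sigma /\
    forall t : 'cV[R]_n,
      char_fun V t = expi (dot t mu) * psi (quad Sigma t).

End elliptical_distribution.

Definition rvec4 (R : realType) (T : Type) (X Y Z W : T -> R) (w : T) :
    'cV[R]_4 :=
  \col_i tnth [tuple X w; Y w; Z w; W w] i.

Section proxies.
Context (R : realType) (d dU : measure_display) (T : measurableType d)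
  (TU : measurableType dU) (P : probability T R).

Definition confounding_bridge (Y Z W : {RV P >-> R}) (U : {RV P >-> TU})
    (h0 g0 : R -> R) : Prop :=
  [/\ measurable_fun [set: R] h0,
      ('E_P[fun w => (h0 (W w) ^+ 2)%R] < +oo)%E &
      cond_exp_eq P (fun w => (U w, Z w)) Y (h0 \o W)] /\
  [/\ measurable_fun [set: R] g0,
      ('E_P[fun w => (g0 (Z w) ^+ 2)%R] < +oo)%E &
      cond_exp_eq P (fun w => (U w, W w)) Y (g0 \o Z)].

(* [E(l(A) | B) = 0] almost surely if and only if [l(A) = 0] almost surely,
   for every Borel [l] with [E(l(A)^2)] finite; the left-hand side says that the
   zero function is a version of [E(l(A) | B)]. *)
Definition complete_for (A B : {RV P >-> R}) : Prop :=
  forall l : R -> R, measurable_fun [set: R] l ->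
    l \o A \in Lfun P 2%:E ->
    is_cond_exp P B (l \o A) (cst 0) <-> {ae P, forall w, l (A w) = 0}.

Definition completeness (Z W : {RV P >-> R}) : Prop :=
  complete_for W Z /\ complete_for Z W.

Definition generalized_tetrad (X Y Z W : {RV P >-> R})
    (h0 g0 : R -> R) : Prop :=
  cond_exp_eq P X Y (h0 \o W) /\ cond_exp_eq P X (h0 \o W) (g0 \o Z).

Definition classical_tetrad (X Y Z W : {RV P >-> R}) : Prop :=
  (covariance P X Y * covariance P Z W = covariance P X Z * covariance P Y W /\
   covariance P X Z * covariance P Y W = covariance P X W * covariance P Y Z)%E.

(* [f(A)] is almost surely an affine function of [A]. *)
Definition as_linear (f : R -> R) (A : {RV P >-> R}) : Prop :=
  exists a b : R, {ae P, forall w, f (A w) = a + b * A w}.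

End proxies.

(* Main.v *)
Require Import Defs.
From mathcomp Require Import all_boot all_order all_algebra.
From mathcomp Require Import all_classical all_reals all_analysis.
From mathcomp Require Import complex ring lra.

Set Implicit Arguments.
Unset Strict Implicit.
Unset Printing Implicit Defensive.

Import Order.TTheory GRing.Theory Num.Theory.
Import numFieldNormedType.Exports.
Import measurable_realfun.

Local Open Scope classical_set_scope.
Local Open Scope ring_scope.

(* If a and b are orthogonal for the scale matrix S, the characteristic function
   shows that a.(V - mu) is uncorrelated with every sin (u b.V + c). Products of
   such sines approximate the indicator of each ray boundedly and pointwise, so
   E(a.(V - mu) | b.V) = 0; in particular all regressions are affine, with slopes
   read off S, and the covariance matrix is k S for some scalar k. If k = 0, all
   variables are constant and both tetrad constraints hold. Otherwise completeness
   excludes S_zw = 0, since it would make E(W - E W | Z) = 0; hence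
   E(Y | Z) = E(m + (S_yz / S_wz) (W - E W) | Z) with m = E Y, and completeness
   identifies h_0(W) with the affine function of W on the right; symmetrically for
   g_0(Z). The generalized tetrad is then the equality of three regression slopes
   on X, which is the classical tetrad divided by S_zw. *)

(** * Elementary bounds for sine and cosine *)

Section sine_estimates.
Context {R : realType}.
Implicit Types x y : R.

Lemma sin_MVT x : 0 <= x -> exists2 c, 0 <= c <= x & sin x = x * cos c.
Proof.
move=> x0; have [c] := @MVT_segment R sin cos 0 x x0
    (fun y _ => is_derive_sin y) (continuous_subspaceT (@continuous_sin R)).
by rewrite in_itv/= sin0 !subr0 mulrC => ? ?; exists c.
Qed.

Lemma ler_norm_sin x : `|sin x| <= `|x|.
Proof.
wlog x0 : x / 0 <= x => [H|].
  have [/H//|/ltW x0] := leP 0 x.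
  by have := H (- x); rewrite oppr_ge0 sinN !normrN; apply.
have [c _ ->] := sin_MVT x0.
by rewrite normrM ler_piMr// ler_norml cos_geN1 cos_le1.
Qed.

Lemma cos_ge_sqr x : 1 - x ^+ 2 / 2 <= cos x.
Proof.
have -> : cos x = 1 - 2 * sin (x / 2) ^+ 2.
  by rewrite {1}[x]splitr cosD -!expr2 cos2sin2; ring.
have := ler_norm_sin (x / 2).
rewrite -(ler_pXn2r (n := 2)) ?nnegrE// !real_normK ?num_real// => h.
by move: h; rewrite !expr2; lra.
Qed.

(** The mean value form [sin x = x * cos c] with [0 <= c <= x] leaves [x * (1 - cos c)], where
    [1 - cos c] is at most [x ^+ 2 / 2]. Oddness reduces to [0 <= x]. *)
Lemma sin_sub_le x : `|sin x - x| <= `|x| ^+ 3 / 2.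
Proof.
wlog x0 : x / 0 <= x => [H|].
  have [/H//|/ltW x0] := leP 0 x.
  by have := H (- x); rewrite oppr_ge0 sinN opprK addrC -normrN opprD opprK addrC
    !normrN addrC; apply.
have [c /andP[c0 cx] ->] := sin_MVT x0.
rewrite -{2}[x]mulr1 -mulrBr normrM (ger0_norm x0) exprS -mulrA ler_wpM2l//.
have c1 := cos_le1 c; have := cos_ge_sqr c.
have : c ^+ 2 <= x ^+ 2 by rewrite ler_pXn2r ?nnegrE.
rewrite ler_norml; lra.
Qed.

Lemma sin_ge_half x : 0 <= x <= 1 -> x / 2 <= sin x.
Proof.
move=> /andP[x0 x1]; have := sin_sub_le x.
rewrite ler_norml (ger0_norm x0) => /andP[+ _].
have : x ^+ 3 <= x by rewrite exprS ler_piMr ?exprn_ile1.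
lra.
Qed.

Lemma bernoulli_inequality x N : 0 <= x -> N%:R * x <= (1 + x) ^+ N.
Proof.
move=> x0; elim: N => [|N IH]; first by rewrite mul0r expr0.
rewrite exprS mulrDl mul1r -natr1 mulrDl mul1r.
apply: lerD => //; rewrite ler_peMr// exprn_ege1// lerDl//.
Qed.

End sine_estimates.

(** * Trigonometric approximation of indicators of rays *)

Section ray_approximation.
Context {R : realType}.
Implicit Types (c z : R) (n : nat).

(* The shift of [c] by [n.+1%:R^-1] keeps the sine positive, not 0, at [z = c]. *)
Definition half_sin n c z : R :=
  (1 + sin (n.+1%:R^-1 * z + (- (n.+1%:R^-1 * (c - n.+1%:R^-1))))) / 2.

(* With [N = n.+1 ^ 3], the polynomial [(1 - h ^+ N) ^+ (2 ^ N)] is close to 1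
   for [h < 1 / 2] and close to 0 for [h > 1 / 2]. *)
Definition ray_approx n c z : R :=
  (1 - half_sin n c z ^+ (n.+1 ^ 3)) ^+ (2 ^ (n.+1 ^ 3)).

Lemma half_sin_itv n c z : 0 <= half_sin n c z <= 1.
Proof.
rewrite /half_sin; set s := sin _.
have := sin_geN1 (n.+1%:R^-1 * z + (- (n.+1%:R^-1 * (c - n.+1%:R^-1)))).
have := sin_le1 (n.+1%:R^-1 * z + (- (n.+1%:R^-1 * (c - n.+1%:R^-1)))).
rewrite -/s; lra.
Qed.

Lemma ray_approx_itv n c z : 0 <= ray_approx n c z <= 1.
Proof.
have /andP[h0 h1] := half_sin_itv n c z.
have h01 N : 0 <= half_sin n c z ^+ N <= 1 by rewrite exprn_ge0 ?exprn_ile1.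
have /andP[a b] := h01 (n.+1 ^ 3)%N.
by rewrite /ray_approx exprn_ge0 ?exprn_ile1//; lra.
Qed.

(** With [x = (1 + s) / 2], Bernoulli's inequality applied twice gives [(1 + x ^+ N) ^+ (2 ^ N) >= 2
    ^ N * x ^+ N = (1 + s) ^+ N >= N * s]. Multiplying the left-hand side by this power yields
    [(1 - (x ^+ N) ^+ 2) ^+ (2 ^ N) <= 1]. *)
Lemma power_step_small (s : R) N : 0 < s <= 1 -> (0 < N)%N ->
  (1 - ((1 + s) / 2) ^+ N) ^+ (2 ^ N) <= (N%:R * s)^-1.
Proof.
move=> /andP[s0 s1] N0; set x := _ / 2.
have x01 : 0 <= x ^+ N <= 1 by rewrite exprn_ge0 ?exprn_ile1// /x; lra.
have Ns : 0 < N%:R * s by rewrite mulr_gt0// ltr0n.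
rewrite -[leLHS]mulr1 -[leRHS]mul1r ler_pdivlMr// mulr1.
apply: (@le_trans _ _ ((1 - x ^+ N) ^+ (2 ^ N) * (1 + x ^+ N) ^+ (2 ^ N))).
  rewrite ler_wpM2l ?exprn_ge0//; first lra.
  apply: (le_trans (bernoulli_inequality N (ltW s0))).
  have -> : (1 + s) ^+ N = (2 ^ N)%:R * x ^+ N.
    by rewrite natrX -exprMn /x mulrC divfK ?pnatr_eq0.
  by apply: bernoulli_inequality; lra.
rewrite -exprMn exprn_ile1//; nra.
Qed.

(** By [1 - (1 - y) ^+ M <= M * y], the left-hand side is at most [(1 + s) ^+ N]. The latter times
    [(1 - s) ^+ N >= N * - s] is at most 1. *)
Lemma power_step_large (s : R) N : -1 <= s < 0 -> (0 < N)%N ->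
  1 - (1 - ((1 + s) / 2) ^+ N) ^+ (2 ^ N) <= (N%:R * - s)^-1.
Proof.
move=> /andP[s1 s0] N0; set x := _ / 2.
have x01 : 0 <= x ^+ N <= 1 by rewrite exprn_ge0 ?exprn_ile1// /x; lra.
have Ns : 0 < N%:R * - s by rewrite mulr_gt0 ?ltr0n// oppr_gt0.
have bern M (y : R) : 0 <= y <= 1 -> 1 - (1 - y) ^+ M <= M%:R * y.
  move=> y01; elim: M => [|M IH]; first by rewrite expr0 mul0r subrr.
  rewrite exprS -natr1.
  have : 0 <= (1 - y) ^+ M <= 1 by rewrite exprn_ge0 ?exprn_ile1//; lra.
  nra.
apply: (le_trans (bern _ _ x01)).
have -> : (2 ^ N)%:R * x ^+ N = (1 + s) ^+ N.
  by rewrite natrX -exprMn /x [2 * _]mulrC divfK ?pnatr_eq0.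
rewrite -[leRHS]mul1r ler_pdivlMr//.
apply: (@le_trans _ _ ((1 + s) ^+ N * (1 + - s) ^+ N)).
  rewrite ler_wpM2l ?exprn_ge0//; first lra.
  by apply: bernoulli_inequality; lra.
rewrite -exprMn exprn_ile1//; nra.
Qed.

(** Here [y] is the argument of the sine in [half_sin]. For [|y| <= 1], [sin y] has the sign of [y]
    and at least half its modulus, so the two power bounds apply with [|s|] at least
    [n.+1%:R^-1 ^+ 2 / 2]. The cubic exponent outweighs this square and leaves an error of order
    [n.+1%:R^-1]. *)
Lemma ray_approx_dist n c z : let y := n.+1%:R^-1 * (z - c + n.+1%:R^-1) in
  `|y| <= 1 -> n.+1%:R^-1 ^+ 2 <= `|y| ->
  `|ray_approx n c z - (y < 0)%R%:R| <= 2 * n.+1%:R^-1.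
Proof.
move=> y y1 yn; have [r0 r1] := andP (ray_approx_itv n c z).
have n0 : 0 < n.+1%:R^-1 :> R by rewrite invr_gt0 ltr0n.
have hE : half_sin n c z = (1 + sin y) / 2.
  by rewrite /half_sin /y; congr ((1 + sin _) / 2); ring.
clearbody y.
have bound s : n.+1%:R^-1 ^+ 2 / 2 <= s ->
    ((n.+1 ^ 3)%:R * s)^-1 <= 2 * n.+1%:R^-1 :> R.
  move=> hs; have s0 : 0 < s by apply: lt_le_trans hs; rewrite divr_gt0 ?exprn_gt0.
  rewrite -[leLHS]mul1r ler_pdivrMr ?mulr_gt0 ?ltr0n ?expn_gt0//.
  have -> : 2 * n.+1%:R^-1 * ((n.+1 ^ 3)%:R * s) = 2 * (n.+1%:R ^+ 2 * s) :> R.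
    by rewrite natrX; field; rewrite addrC natr1 pnatr_eq0.
  have : n.+1%:R ^+ 2 * (n.+1%:R^-1 ^+ 2 / 2) <= n.+1%:R ^+ 2 * s :> R.
    by rewrite ler_wpM2l// exprn_ge0.
  rewrite mulrA -exprMn divff ?pnatr_eq0// expr1n; lra.
rewrite /ray_approx hE; case: ltP => y0 /=.
  have sy : - y / 2 <= - sin y.
    by rewrite -sinN sin_ge_half// oppr_ge0 ltW//= -[- y]ger0_norm ?normrN// oppr_ge0 ltW.
  rewrite distrC ger0_norm; last first.
    by move: r1; rewrite /ray_approx hE => r1; rewrite subr_ge0.
  have ny : `|y| = - y by rewrite ltr0_norm.
  apply: le_trans (power_step_large _ _) _; rewrite ?expn_gt0//.
    by rewrite sin_geN1/=; lra.
  by apply: bound; apply: le_trans sy; rewrite -ny ler_pM2r ?invr_gt0.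
rewrite subr0 ger0_norm; last by move: r0; rewrite /ray_approx hE.
have ny : `|y| = y by rewrite ger0_norm.
have sy : y / 2 <= sin y by rewrite sin_ge_half// y0 -ny.
have yp : 0 < y by rewrite -ny (lt_le_trans _ yn)// exprn_gt0.
apply: le_trans (power_step_small _ _) _; rewrite ?expn_gt0//.
  by rewrite sin_le1 andbT; lra.
by apply: bound; apply: le_trans sy; rewrite -ny ler_pM2r ?invr_gt0.
Qed.

Lemma cvg_ray_approx c z :
  ray_approx n c z @[n --> \oo] --> ((z < c)%R%:R : R).
Proof.
apply/cvgrPdist_le => e e0.
have small (k : R) : 0 < k -> \forall n \near \oo, n.+1%:R^-1 <= k.
  move=> k0; have /cvgrPdist_le/(_ _ k0) := @cvg_harmonic R.
  by apply: filterS => m; rewrite sub0r normrN ger0_norm// invr_ge0.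
(* Below [c], the shift must eventually cost at most half the distance to [c]; then
   [z - c + i <= - i] for [i = n.+1%:R^-1], hence [y <= - i ^+ 2]. At or above [c], the shift alone
   gives [y >= i ^+ 2]. *)
have zc_small : \forall n \near \oo, z < c -> n.+1%:R^-1 <= (c - z) / 2.
  have [_|zc] := leP c z; first by apply: nearW.
  by apply: filterS (small ((c - z) / 2) _) => //; lra.
near=> n.
have ic : z < c -> n.+1%:R^-1 <= (c - z) / 2 by near: n.
have ie : n.+1%:R^-1 <= e / 2 by near: n; apply: small; rewrite divr_gt0.
have ibig : n.+1%:R^-1 * (`|z - c| + 1) <= 1.
  rewrite -ler_pdivlMr; last by rewrite ltr_pwDr.
  by rewrite mul1r; near: n; apply: small; rewrite invr_gt0 ltr_pwDr.
have i0 : 0 < n.+1%:R^-1 :> R by rewrite invr_gt0 ltr0n.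
have i1 : n.+1%:R^-1 <= 1 :> R by rewrite invf_le1// ?ltr0n// ler1n.
pose y : R := n.+1%:R^-1 * (z - c + n.+1%:R^-1).
have := @ray_approx_dist n c z; rewrite /= -/y.
move: (n.+1%:R^-1) => i in i0 i1 ic ie ibig y *.
have y1 : `|y| <= 1.
  rewrite normrM gtr0_norm// (le_trans _ ibig)// ler_pM2l//.
  by rewrite (le_trans (ler_normD _ _))// lerD2l gtr0_norm.
have ysg : (y < 0) = (z < c) /\ i ^+ 2 <= `|y|.
  have [cz|zc] := leP c z.
    have zc0 : 0 <= z - c by rewrite subr_ge0.
    have y0 : i ^+ 2 <= y by rewrite expr2 ler_pM2l// lerDr.
    split; last by rewrite (le_trans y0)// ler_norm.
    by apply/negbTE; rewrite -leNgt (le_trans _ y0)// exprn_ge0// ltW.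
  move/(_ zc): ic => ic.
  have y0 : y <= - i ^+ 2.
    by rewrite /y expr2 -mulrN ler_pM2l//; lra.
  split; first by rewrite (le_lt_trans y0)// oppr_lt0 exprn_gt0.
  by rewrite -[leRHS]normrN (le_trans _ (ler_norm _))// lerNr.
move=> /(_ y1 ysg.2); rewrite ysg.1 distrC.
by move=> /le_trans; apply; rewrite mulrC -ler_pdivlMr.
Unshelve. all: by end_near. Qed.

(** This recovers an unbounded variable from bounded sines. As [|sin x| <= |x|], the approximants
    are dominated by [|z|], which makes dominated convergence applicable later. *)
Lemma cvg_scaled_sin z : n.+1%:R * sin (n.+1%:R^-1 * z) @[n --> \oo] --> z.
Proof.
apply/cvgrPdist_le => e e0; near=> n.
have iK : n.+1%:R^-1 * (`|z| ^+ 3 + 1) <= e.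
  rewrite -ler_pdivlMr ?ltr_wpDl//.
  near: n; have k0 : 0 < e / (`|z| ^+ 3 + 1) by rewrite divr_gt0// ltr_wpDl.
  have /cvgrPdist_le/(_ _ k0) := @cvg_harmonic R.
  by apply: filterS => m; rewrite sub0r normrN ger0_norm// invr_ge0.
have n0 : 0 < n.+1%:R^-1 :> R by rewrite invr_gt0 ltr0n.
have i1 : n.+1%:R^-1 <= 1 :> R by rewrite invf_le1// ?ltr0n// ler1n.
rewrite -{1}[n.+1%:R]invrK.
move: (n.+1%:R^-1) => i in n0 i1 iK *.
have -> : z - i^-1 * sin (i * z) = - (i^-1 * (sin (i * z) - i * z)).
  by rewrite mulrBr opprB mulKf// gt_eqF.
rewrite normrN normrM gtr0_norm ?invr_gt0// mulrC ler_pdivrMr//.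
apply: (le_trans (sin_sub_le _)).
rewrite normrM (gtr0_norm n0) exprMn exprS -mulrA -mulrA mulrC ler_pM2r//.
have z3 : 0 <= `|z| ^+ 3 by [].
have : i ^+ 2 * `|z| ^+ 3 <= i * `|z| ^+ 3.
  by rewrite ler_wpM2r// expr2 ler_piMr// ltW.
have : 0 <= i ^+ 2 * `|z| ^+ 3 by rewrite mulr_ge0// exprn_ge0// ltW.
nra.
Unshelve. all: by end_near. Qed.

End ray_approximation.

(** * Integrability and passage to the limit *)

Section integral_lemmas.
Context {R : realType} {d : measure_display} {T : measurableType d}
  {P : probability T R}.
Implicit Types A B F f g : T -> R.

Lemma measurable_sin_comp F :
  measurable_fun setT F -> measurable_fun setT (fun w => sin (F w)).
Proof.
move=> mF; apply: measurableT_comp mF.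
by apply: continuous_measurable_fun; exact: continuous_sin.
Qed.

Lemma integrableD_EFin A B :
  P.-integrable setT (EFin \o A) -> P.-integrable setT (EFin \o B) ->
  P.-integrable setT (EFin \o (fun w => A w + B w)).
Proof. by move=> iA iB; apply: eq_integrable (integrableD _ iA iB). Qed.

Lemma integrableB_EFin A B :
  P.-integrable setT (EFin \o A) -> P.-integrable setT (EFin \o B) ->
  P.-integrable setT (EFin \o (fun w => A w - B w)).
Proof. by move=> iA iB; apply: eq_integrable (integrableB _ iA iB). Qed.

Lemma integrableZl_EFin k A : P.-integrable setT (EFin \o A) ->
  P.-integrable setT (EFin \o (fun w => k * A w)).
Proof. by move=> iA; apply: eq_integrable (integrableZl _ k iA). Qed.

Lemma integrable_mul_bounded A F K : P.-integrable setT (EFin \o A) ->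
  measurable_fun setT F -> (forall w, `|F w| <= K) ->
  P.-integrable setT (EFin \o (fun w => A w * F w)).
Proof.
move=> iA mF FK.
have mA : measurable_fun setT A by exact/measurable_EFinP/(measurable_int _ iA).
have iK := integrableZl measurableT K (integrable_norm iA).
apply: le_integrable iK => //.
  by apply/measurable_EFinP/measurable_funM.
move=> w _ /=; rewrite lee_fin normrM mulrC.
by rewrite [leRHS]ger0_norm ?ler_wpM2r// mulr_ge0// (le_trans _ (FK w)).
Qed.

Lemma Rintegral_lim0 (f_ : nat -> T -> R) f g :
  (forall n, measurable_fun setT (f_ n)) -> measurable_fun setT f ->
  (forall w, f_ n w @[n --> \oo] --> f w) ->
  P.-integrable setT (EFin \o g) -> (forall n w, `|f_ n w| <= g w) ->
  (forall n, \int[P]_w f_ n w = 0) -> \int[P]_w f w = 0.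
Proof.
move=> mf_ mf f_f ig f_g f_0.
have [] := @dominated_convergence _ _ _ P _ measurableT
  (fun n => EFin \o f_ n) (EFin \o f) (EFin \o g).
- by move=> n; exact/measurable_EFinP.
- exact/measurable_EFinP.
- by apply: aeW => w _; apply: cvg_EFin; [exact: nearW|exact: f_f].
- exact: ig.
- by apply: aeW => w n _; rewrite lee_fin.
move=> _ _; rewrite /= (_ : (fun n => _) = cst 0%E); last first.
  apply/funext => n /=; move: (f_0 n); rewrite /Rintegral.
  (* [f_0] is about [fine], which also sends infinite values to 0; domination by [g] makes the
     integral finite, so that it is really 0. *)
  have /integrable_fin_num : P.-integrable setT (EFin \o f_ n).
    apply: le_integrable ig => //; first exact/measurable_EFinP.
    by move=> w _ /=; rewrite lee_fin (le_trans (f_g n w))// ler_norm.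
  by move=> /(_ measurableT) fin f0; rewrite -[LHS]fineK// [fine _]f0.
by move=> /cvg_lim => /(_ _ ); rewrite lim_cst// /Rintegral => <-.
Qed.

End integral_lemmas.

(** * Uniqueness: orthogonality to all sines of [Z] implies orthogonality to all events of [Z] *)

Section fourier_uniqueness.
Context {R : realType} {d : measure_display} {T : measurableType d}
  {P : probability T R}.
Variables A Z : T -> R.
Hypotheses (iA : P.-integrable setT (EFin \o A)) (mZ : measurable_fun setT Z).

(* This class is stable under multiplication by [sin (u * Z w + c)], hence by
   trigonometric polynomials. *)
Definition trig_null (F : T -> R) := [/\ measurable_fun setT F,
  exists K : R, forall w, `|F w| <= K &
  forall u c, \int[P]_w (A w * (F w * sin (u * Z w + c))) = 0].

Let mA : measurable_fun setT A.
Proof. exact/measurable_EFinP/(measurable_int _ iA). Qed.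

Let integrable_trig (F : T -> R) (u c : R) : measurable_fun setT F ->
  (exists K : R, forall w, `|F w| <= K) ->
  P.-integrable setT (EFin \o (fun w => A w * (F w * sin (u * Z w + c)))).
Proof.
move=> mF [K FK]; apply: (@integrable_mul_bounded _ _ _ _ _ _ K) => //.
  apply: measurable_funM => //; apply: measurable_sin_comp.
  by apply: measurable_funD => //; exact: measurable_funM.
move=> w; rewrite normrM -[leRHS]mulr1 ler_pM//; exact: sin_max.
Qed.

Lemma trig_nullD F G : trig_null F -> trig_null G ->
  trig_null (fun w => F w + G w).
Proof.
move=> [mF bF F0] [mG bG G0]; split; first exact: measurable_funD.
  have [[K FK] [L GL]] := (bF, bG); exists (K + L) => w.
  by rewrite (le_trans (ler_normD _ _))// lerD.
move=> u c; under eq_Rintegral do rewrite mulrDl mulrDr.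
by rewrite RintegralD ?F0 ?G0 ?addr0//; exact: integrable_trig.
Qed.

Lemma trig_nullZ k F : trig_null F -> trig_null (fun w => k * F w).
Proof.
move=> [mF bF F0]; split; first exact: measurable_funM.
  have [K FK] := bF; exists (`|k| * K) => w.
  by rewrite normrM ler_wpM2l.
move=> u c; under eq_Rintegral do rewrite -mulrA mulrCA.
by rewrite RintegralZl ?F0 ?mulr0//; exact: integrable_trig.
Qed.

(** The product formula [sin p * sin q = (cos (p - q) - cos (p + q)) / 2] reduces to single
    frequencies, and a shift by [pi / 2] turns each cosine back into a sine. *)
Lemma trig_null_sin u c F : trig_null F ->
  trig_null (fun w => sin (u * Z w + c) * F w).
Proof.
move=> [mF bF F0]; split.
- apply: measurable_funM => //; apply: measurable_sin_comp.
  by apply: measurable_funD => //; exact: measurable_funM.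
- have [K FK] := bF; exists K => w; rewrite normrM -[leRHS]mul1r ler_pM//.
  exact: sin_max.
move=> v e; transitivity (\int[P]_w (2^-1 *
    (A w * (F w * sin ((v - u) * Z w + (e - c + pi / 2))) -
     A w * (F w * sin ((v + u) * Z w + (e + c + pi / 2)))))).
  apply: eq_Rintegral => w _.
  have -> : (v - u) * Z w + (e - c + pi / 2) =
    (v * Z w + e) - (u * Z w + c) + pi / 2 by ring.
  have -> : (v + u) * Z w + (e + c + pi / 2) =
    (v * Z w + e) + (u * Z w + c) + pi / 2 by ring.
  move: (v * Z w + e) (u * Z w + c) => p q.
  by rewrite !sinDpihalf cosB cosD; field.
rewrite RintegralZl//; last first.
  by apply: integrableB_EFin; exact: integrable_trig.
by rewrite RintegralB ?F0 ?subrr ?mulr0//; exact: integrable_trig.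
Qed.

(** [ray_approx] is built from the constant 1 by repeated multiplication by [half_sin], sums and
    scalings, all of which preserve the class. *)
Lemma trig_null_ray_approx n c : trig_null (cst 1) ->
  trig_null (fun w => ray_approx n c (Z w)).
Proof.
move=> h1.
have hX F : trig_null F -> trig_null (fun w => half_sin n c (Z w) * F w).
  move=> hF; have := trig_nullZ 2^-1 (trig_nullD hF
    (trig_null_sin n.+1%:R^-1 (- (n.+1%:R^-1 * (c - n.+1%:R^-1))) hF)).
  by congr trig_null; apply/funext => w; rewrite /half_sin; field.
have hXN N F : trig_null F -> trig_null (fun w => half_sin n c (Z w) ^+ N * F w).
  move=> hF; elim: N => [|N /hX].
    by under eq_fun do rewrite expr0 mul1r.
  by congr trig_null; apply/funext => w; rewrite exprS mulrA.
have hC N F : trig_null F ->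
    trig_null (fun w => (1 - half_sin n c (Z w) ^+ N) * F w).
  move=> hF; have := trig_nullD hF (trig_nullZ (-1) (hXN N _ hF)).
  by congr trig_null; apply/funext => w; ring.
rewrite /ray_approx; elim: (2 ^ _)%N => [|M /(hC (n.+1 ^ 3)%N)].
  by under eq_fun do rewrite expr0.
by congr trig_null; apply/funext => w; rewrite exprS.
Qed.

Hypothesis trig0 : forall u c, \int[P]_w (A w * sin (u * Z w + c)) = 0.

Lemma trig_null1 : trig_null (cst 1).
Proof.
split => //; first by exists 1 => w; rewrite normr1.
by move=> u c; under eq_Rintegral do rewrite mul1r.
Qed.

(** The approximants take values in [[0, 1]] and tend pointwise to the indicator of the ray, so
    [|A|] dominates and the zero integrals pass to the limit. *)
Lemma Rintegral_preimage_ray0 c : \int[P]_(w in Z @^-1` `]-oo, c[) A w = 0.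
Proof.
have mc : measurable (Z @^-1` `]-oo, c[).
  rewrite -[X in measurable X]setTI; apply: mZ => //; exact: measurable_itv.
rewrite Rintegral_mkcond.
apply: (@Rintegral_lim0 _ _ _ _ (fun n w => A w * ray_approx n c (Z w)) _
  (fun w => `|A w|)).
- move=> n; apply: measurable_funM => //.
  by have [] := trig_null_ray_approx n c trig_null1.
- by apply: (measurable_restrictT A mc).1; exact: measurable_funS mA.
- move=> w; rewrite [X in _ --> X](_ : _ = A w * (Z w < c)%R%:R).
    by apply: cvgM; [exact: cvg_cst|exact: cvg_ray_approx].
  rewrite patchE (_ : (w \in _) = (Z w < c)).
    by case: ifP; rewrite ?mulr1 ?mulr0.
  by apply/idP/idP; rewrite inE/= in_itv.
- exact: integrable_norm.
- move=> n w; have /andP[r0 r1] := ray_approx_itv n c (Z w).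
  by rewrite normrM ler_piMr// ger0_norm.
(* Frequency 0 and phase [pi / 2] make the sine factor equal to 1. *)
- move=> n; have [_ _ /(_ 0 (pi / 2))] := trig_null_ray_approx n c trig_null1.
  by under eq_Rintegral do rewrite mul0r add0r sin_pihalf mulr1.
Qed.

(** Dynkin's pi-lambda theorem: open left rays are stable under intersection and generate the Borel
    sets, and the sets with zero integral contain the whole line and are closed under complements
    and countable disjoint unions. *)
Lemma Rintegral_preimage0 (D : set R) : measurable D ->
  \int[P]_(w in Z @^-1` D) A w = 0.
Proof.
have mp (B : set R) : measurable B -> measurable (Z @^-1` B).
  by move=> mB; rewrite -[X in measurable X]setTI; exact: mZ.
have AT : \int[P]_w A w = 0.
  have := trig0 0 (pi / 2).
  by under eq_Rintegral do rewrite mul0r add0r sin_pihalf mulr1.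
have iAS (B : set R) : measurable B -> P.-integrable (Z @^-1` B) (EFin \o A).
  by move=> mB; exact: (integrableS measurableT (mp _ mB) _ iA).
have mE : @measurable _ R = <<s @RGenInftyO.G R >>.
  exact: RGenInftyO.measurableE.
rewrite [X in X D -> _]mE => mD.
apply: (@dynkin_induction _ R (@RGenInftyO.G R)
  (fun D => \int[P]_(w in Z @^-1` D) A w = 0)) mD.
- exact: mE.
- move=> _ _ [x ->] [y ->]; exists (Num.min x y).
  apply/seteqP; split => z /=; rewrite !in_itv/= lt_min.
    by move=> [-> ->].
  by move=> /andP[-> ->].
- by rewrite preimage_setT.
- by move=> _ [c ->]; exact: Rintegral_preimage_ray0.
- move=> S mS S0; have := AT.
  rewrite -(setUv (Z @^-1` S)) Rintegral_setU ?S0 ?add0r//.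
  + exact: mp.
  + exact/measurableC/mp.
  + by rewrite setUv.
  + by apply/disj_set2P; rewrite setICr.
- move=> F mF tF F0; rewrite preimage_bigcup /Rintegral integral_bigcup.
  + rewrite eseries0// => n _ _; rewrite -[LHS]fineK; last first.
      by apply: integrable_fin_num; [exact: mp|exact: iAS].
    by rewrite [fine _]F0.
  + by move=> i j _ _ [w [Fi Fj]]; apply: tF => //; exists (Z w).
  + by move=> k; exact: mp.
  + by rewrite -preimage_bigcup; apply: iAS; exact: bigcup_measurable.
Qed.

End fourier_uniqueness.

(** * Linear and bilinear forms on column vectors *)

Section dot_product.
Context {R : realType} {n : nat}.
Implicit Types (a b c : 'cV[R]_n) (S : 'M[R]_n) (k : R).

Definition sig S a b : R := (a^T *m S *m b) 0 0.

Lemma dotE a b : dot a b = \sum_i a i 0 * b i 0.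
Proof. by rewrite /dot mxE; apply: eq_bigr => i _; rewrite mxE. Qed.

Lemma dotDl a b c : dot (a + b) c = dot a c + dot b c.
Proof. by rewrite /dot linearD mulmxDl mxE. Qed.

Lemma dotZl k a c : dot (k *: a) c = k * dot a c.
Proof. by rewrite /dot linearZ -scalemxAl mxE. Qed.

Lemma dot_delta i a : dot (delta_mx i 0) a = a i 0.
Proof. by rewrite /dot trmx_delta -rowE mxE. Qed.

Lemma sigDl S a b c : sig S (a + b) c = sig S a c + sig S b c.
Proof. by rewrite /sig linearD !mulmxDl mxE. Qed.

Lemma sigZl S k a c : sig S (k *: a) c = k * sig S a c.
Proof. by rewrite /sig linearZ -!scalemxAl mxE. Qed.

Lemma sigC S a b : S^T = S -> sig S a b = sig S b a.
Proof.
move=> ST; transitivity ((b^T *m S *m a)^T 0 0); last by rewrite mxE.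
by rewrite !trmx_mul trmxK ST mulmxA.
Qed.

Lemma quad_sig S a : quad S a = sig S a a. Proof. by []. Qed.

Lemma sig_delta S i j : sig S (delta_mx i 0) (delta_mx j 0) = S i j.
Proof. by rewrite /sig trmx_delta -rowE -colE !mxE. Qed.

End dot_product.

(** * Square-integrable variables and bounded trigonometric integrands *)

Lemma Lfun2_lin {R : realType} {d} {T : measurableType d} {P : probability T R}
    (k : R) (f g : T -> R) : f \in Lfun P 2%:E -> g \in Lfun P 2%:E ->
  (fun w => k * f w + g w) \in Lfun P 2%:E.
Proof. by move=> fP gP; exact: (Lfun_submod_closed P (lee1n 2)).2 k f g fP gP. Qed.

Lemma Lfun2_measurable {R : realType} {d} {T : measurableType d}
    {P : probability T R} (f : T -> R) :
  f \in Lfun P 2%:E -> measurable_fun setT f.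
Proof. by move=> /sub_Lfun_mfun; rewrite inE. Qed.

Lemma Lfun2_integrable {R : realType} {d} {T : measurableType d}
    {P : probability T R} (f : T -> R) :
  f \in Lfun P 2%:E -> P.-integrable setT (EFin \o f).
Proof.
move=> f2; apply/Lfun1_integrable; apply: Lfun_subset12 f2.
by rewrite fin_num_measure.
Qed.

Lemma Lfun2_integrable_mul {R : realType} {d} {T : measurableType d}
    {P : probability T R} (f g : T -> R) :
  f \in Lfun P 2%:E -> g \in Lfun P 2%:E ->
  P.-integrable setT (EFin \o (fun w => f w * g w)).
Proof. by move=> f2 g2; exact/Lfun1_integrable/(Lfun2_mul_Lfun1 f2 g2). Qed.

Lemma integrable_cos {R : realType} {d} {T : measurableType d}
    {P : probability T R} (f : T -> R) : measurable_fun setT f ->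
  P.-integrable setT (EFin \o (fun w => cos (f w))).
Proof.
move=> mf; have i1 : P.-integrable setT (EFin \o cst (1 : R)).
  exact: finite_measure_integrable_cst.
apply: le_integrable i1 => //.
  apply/measurable_EFinP; apply: measurableT_comp mf.
  by apply: continuous_measurable_fun; exact: continuous_cos.
by move=> w _; rewrite /= lee_fin normr1 cos_max.
Qed.

Lemma integrable_sin {R : realType} {d} {T : measurableType d}
    {P : probability T R} (f : T -> R) : measurable_fun setT f ->
  P.-integrable setT (EFin \o (fun w => sin (f w))).
Proof.
move=> mf.
rewrite (_ : (fun w => sin (f w)) = (fun w => cos (f w + (- (pi / 2))))).
  by apply: integrable_cos; exact: measurable_funD.
by apply/funext => w; rewrite cosBpihalf.
Qed.

Lemma Rintegral_norm_eq0 {R : realType} {d} {T : measurableType d}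
    {P : probability T R} (f : T -> R) :
  P.-integrable setT (EFin \o f) -> \int[P]_w `|f w| = 0 ->
  {ae P, forall w, f w = 0}.
Proof.
move=> iF f0.
have [+ _] := @ae_eq_integral_abs _ _ _ P setT measurableT
  (EFin \o f) (measurable_int _ iF).
have := integrable_fin_num measurableT (integrable_norm iF) => fin.
have -> : (\int[P]_w `|(EFin \o f) w| = 0)%E.
  by rewrite -[LHS]fineK//; congr EFin.
by move=> /(_ erefl); apply: filterS => w /(_ I) [].
Qed.

(** * Regression and covariance of an elliptical vector *)

Section elliptical_moments.
Context {R : realType} {d : measure_display} {T : measurableType d}
  {P : probability T R} {n : nat}.
Variables (V : T -> 'cV[R]_n) (mu : 'cV[R]_n) (S : 'M[R]_n) (psi : R -> R[i]).
Hypotheses (V2 : forall i, (fun w => V w i 0) \in Lfun P 2%:E)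
  (S_pos : posdef S)
  (V_char : forall t, char_fun P V t = expi (dot t mu) * psi (quad S t)).
Implicit Types (a b t : 'cV[R]_n) (k u c : R).

(** The centring uses the location parameter; that it is the mean is established in
    [Rintegral_dev]. *)
Definition dev a w := dot a (V w) - dot a mu.

Lemma devD a b w : dev (a + b) w = dev a w + dev b w.
Proof. by rewrite /dev !dotDl; ring. Qed.

Lemma devZ k a w : dev (k *: a) w = k * dev a w.
Proof. by rewrite /dev !dotZl; ring. Qed.

Lemma Lfun2_dot a : (fun w => dot a (V w)) \in Lfun P 2%:E.
Proof.
under eq_fun do rewrite dotE.
rewrite (_ : (fun w => _) = \sum_(i < n) (fun w => a i 0 * V w i 0)).
  elim/big_rec: _ => [|i f _ f2]; first exact: (Lfun_cst P 0 2).
  exact: Lfun2_lin.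
by apply/funext => w; rewrite fct_sumE.
Qed.

Lemma Lfun2_dev a : dev a \in Lfun P 2%:E.
Proof.
have := Lfun2_lin 1 (Lfun2_dot a) (Lfun_cst P (- dot a mu) 2).
by under eq_fun do rewrite mul1r.
Qed.

Let measurable_dev a : measurable_fun setT (dev a).
Proof. exact: Lfun2_measurable (Lfun2_dev a). Qed.

Let integrable_dev a : P.-integrable setT (EFin \o dev a).
Proof. exact: Lfun2_integrable (Lfun2_dev a). Qed.

(** The right-hand side is the real part of [expi c * psi (quad S t)]: centring removes the phase
    [expi (dot t mu)]. Hence the integral depends on [t] only through [quad S t]. *)
Lemma Rintegral_cos_dev t c : \int[P]_w cos (dev t w + c) =
  cos c * complex.Re (psi (quad S t)) - sin c * complex.Im (psi (quad S t)).
Proof.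
have mt : measurable_fun setT (fun w => dot t (V w)).
  exact: Lfun2_measurable (Lfun2_dot t).
have := V_char t; case: (psi (quad S t)) => p q V_t.
have [cosE sinE] :
    \int[P]_w cos (dot t (V w)) = cos (dot t mu) * p - sin (dot t mu) * q /\
    \int[P]_w sin (dot t (V w)) = cos (dot t mu) * q + sin (dot t mu) * p.
  by move: V_t; rewrite /char_fun /expi !unlock => -[].
rewrite [complex.Re _]/= [complex.Im _]/=.
(* The phase [c - dot t mu] is split off as a constant; its [mu] part cancels against that of
   [V_char] by [cos ^+ 2 + sin ^+ 2 = 1]. *)
transitivity (\int[P]_w (cos (c - dot t mu) * cos (dot t (V w)) -
    sin (c - dot t mu) * sin (dot t (V w)))).
  have split_cos (v x : R) : cos (v - x + c) = cos (c - x) * cos v - sin (c - x) * sin v.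
    have -> : v - x + c = v + (c - x) by ring.
    by rewrite (@cosD R v) mulrC (mulrC (sin v)).
  by apply: eq_Rintegral => w _; exact: split_cos.
rewrite RintegralB//; last 2 first.
- by apply: integrableZl_EFin; exact: integrable_cos.
- by apply: integrableZl_EFin; exact: integrable_sin.
rewrite !RintegralZl//; last 2 first.
- exact: integrable_sin.
- exact: integrable_cos.
rewrite cosE sinE sinB cosB.
have := cos2Dsin2 (dot t mu); set x := cos (dot t mu); set y := sin (dot t mu).
move=> xy; transitivity ((x ^+ 2 + y ^+ 2) * (cos c * p - sin c * q)); first ring.
by rewrite xy mul1r.
Qed.

(* For orthogonal [a] and [b], the characteristic function at
   [k *: a + u *: b] is even in [k] up to the phase, so its odd part
   [E(sin (k dev a) sin (u dev b + c))] vanishes; divide by [k] and let it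
   tend to 0. *)
Lemma Rintegral_dev_sin a b u c : sig S a b = 0 ->
  \int[P]_w (dev a w * sin (u * dev b w + c)) = 0.
Proof.
move=> ab.
have ba : sig S b a = 0 by rewrite sigC// S_pos.1.
have sin0 k : \int[P]_w (sin (k * dev a w) * sin (u * dev b w + c)) = 0.
  have quadE : quad S ((- k) *: a + u *: b) = quad S (k *: a + u *: b).
    have S_sym := S_pos.1; rewrite !quad_sig !(sigDl, sigZl).
    rewrite ![sig S a (_ + _)]sigC// ![sig S b (_ + _)]sigC//.
    by rewrite !(sigDl, sigZl) ab ba; ring.
  have := Rintegral_cos_dev ((- k) *: a + u *: b) c.
  rewrite quadE -Rintegral_cos_dev => /eqP; rewrite -subr_eq0 -RintegralB//; last 2 first.
  - by apply: integrable_cos; exact: measurable_funD.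
  - by apply: integrable_cos; exact: measurable_funD.
  have diff_cos (x y : R) : cos (- x + y) - cos (x + y) = 2 * (sin x * sin y).
    by rewrite (cosD (- x)) (cosD x) cosN sinN; ring.
  move=> /eqP; under eq_Rintegral do rewrite !devD !devZ mulNr -!addrA diff_cos.
  rewrite RintegralZl//; last first.
    apply: (@integrable_mul_bounded _ _ _ _ _ _ 1).
    - by apply: integrable_sin; exact: measurable_funM.
    - by apply: measurable_sin_comp; apply: measurable_funD => //; exact: measurable_funM.
    - by move=> w; exact: sin_max.
  by move=> /eqP; rewrite mulf_eq0 pnatr_eq0/= => /eqP.
have msin k v e b' : measurable_fun setT (fun w => k * sin (v * dev b' w + e)).
  apply: measurable_funM => //; apply: measurable_sin_comp.
  by apply: measurable_funD => //; exact: measurable_funM.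
(* The neutral [+ 0] and [1 *] give both factors the shape of [msin]. *)
apply: (@Rintegral_lim0 _ _ _ _ (fun m w =>
  m.+1%:R * sin (m.+1%:R^-1 * dev a w + 0) * (1 * sin (u * dev b w + c))) _
  (fun w => `|dev a w|)).
- by move=> m; apply: measurable_funM.
- by apply: measurable_funM => //; have := msin 1 u c b; under eq_fun do rewrite mul1r.
- move=> w; rewrite mul1r; apply: cvgM; last exact: cvg_cst.
  by under eq_fun do rewrite addr0; exact: cvg_scaled_sin.
- exact: integrable_norm.
- move=> m w; rewrite addr0 mul1r normrM -[leRHS]mulr1 ler_pM// ?sin_max//.
  rewrite normrM (le_trans (ler_wpM2l _ (ler_norm_sin _)))//.
  by rewrite normrM mulrA -normrM divff ?pnatr_eq0// normr1 mul1r.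
- move=> m; under eq_Rintegral do rewrite addr0 mul1r -mulrA.
  rewrite RintegralZl ?sin0 ?mulr0//.
  apply: (@integrable_mul_bounded _ _ _ _ _ _ 1).
  - by apply: integrable_sin; exact: measurable_funM.
  - by apply: measurable_sin_comp; apply: measurable_funD => //; exact: measurable_funM.
  - by move=> w; exact: sin_max.
Qed.

Lemma elliptical_regression a b (D : set R) : sig S a b = 0 -> measurable D ->
  \int[P]_(w in (fun w => dot b (V w)) @^-1` D) dev a w = 0.
Proof.
move=> ab mD; apply: Rintegral_preimage0 => //.
- exact: Lfun2_measurable (Lfun2_dot b).
(* The phase [u * dot b mu] undoes the centring of [dev b]. *)
- move=> u c; rewrite -(Rintegral_dev_sin u (c + u * dot b mu) ab).
  by apply: eq_Rintegral => w _; congr (_ * sin _); rewrite /dev; ring.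
Qed.

(** Every [a] is orthogonal to the vector 0, and the whole line is an admissible event. *)
Lemma Rintegral_dev a : \int[P]_w dev a w = 0.
Proof.
rewrite -(@elliptical_regression a 0 setT) ?preimage_setT//.
by rewrite /sig mulmx0 mxE.
Qed.

Definition cov a b := \int[P]_w (dev a w * dev b w).

Lemma covC a b : cov a b = cov b a.
Proof. by apply: eq_Rintegral => w _; rewrite mulrC. Qed.

Lemma covDl a b t : cov (a + b) t = cov a t + cov b t.
Proof.
rewrite /cov -RintegralD//; try exact: Lfun2_integrable_mul (Lfun2_dev _) (Lfun2_dev _).
by apply: eq_Rintegral => w _; rewrite devD mulrDl.
Qed.

Lemma covZl k a t : cov (k *: a) t = k * cov a t.
Proof.
rewrite /cov -RintegralZl//; last exact: Lfun2_integrable_mul (Lfun2_dev _) (Lfun2_dev _).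
by apply: eq_Rintegral => w _; rewrite devZ mulrA.
Qed.

(** [dev b] is the limit of scaled sines of itself, each uncorrelated with [dev a];
    [|dev a * dev b|] dominates and is integrable. *)
Lemma cov_orthogonal a b : sig S a b = 0 -> cov a b = 0.
Proof.
move=> ab.
apply: (@Rintegral_lim0 _ _ _ _ (fun m w =>
  dev a w * (m.+1%:R * sin (m.+1%:R^-1 * dev b w))) _
  (fun w => `|dev a w * dev b w|)).
- move=> m; apply: measurable_funM => //; apply: measurable_funM => //.
  by apply: measurable_sin_comp; exact: measurable_funM.
- exact: measurable_funM.
- by move=> w; apply: cvgM; [exact: cvg_cst|exact: cvg_scaled_sin].
- exact/integrable_norm/(Lfun2_integrable_mul (Lfun2_dev _) (Lfun2_dev _)).
- move=> m w; rewrite !normrM ler_wpM2l//.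
  rewrite (le_trans (ler_wpM2l _ (ler_norm_sin _)))//.
  by rewrite normrM mulrA -normrM divff ?pnatr_eq0// normr1 mul1r.
- move=> m; under eq_Rintegral do rewrite mulrCA.
  rewrite RintegralZl//.
    by have := Rintegral_dev_sin m.+1%:R^-1 0 ab;
      under eq_Rintegral do rewrite addr0; move=> ->; rewrite mulr0.
  apply: (@integrable_mul_bounded _ _ _ _ _ _ 1) => //.
  - by apply: measurable_sin_comp; exact: measurable_funM.
  - by move=> w; exact: sin_max.
Qed.

(** A Gram-Schmidt step without division: [sig S a a *: b - sig S b a *: a] is orthogonal to [a] for
    [S], hence for [cov]. *)
Lemma cov_sig_cross a b : sig S a a * cov b a = cov a a * sig S b a.
Proof.
have S_sym := S_pos.1.
have : cov (sig S a a *: b + (- sig S b a) *: a) a = 0.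
  by apply: cov_orthogonal; rewrite !(sigDl, sigZl); ring.
by rewrite covDl !covZl mulNr => /eqP; rewrite subr_eq0 => /eqP ->; rewrite mulrC.
Qed.

Lemma sig_gt0 a : a != 0 -> 0 < sig S a a.
Proof. exact: S_pos.2. Qed.

(* Orthogonality for [S] implies orthogonality for [cov], which forces the two
   bilinear forms to be proportional. *)
Lemma cov_proportional : exists k, forall a b, cov a b = k * sig S a b.
Proof.
have S_sym := S_pos.1.
(* A nonzero reference vector [e] fixes the ratio; if none exists, both forms are zero. *)
have [[e e0]|H] := pselect (exists e : 'cV[R]_n, e != 0); last first.
  exists 0 => a b; rewrite mul0r; apply: cov_orthogonal.
  have -> : a = 0 by apply: contra_notP H => /eqP a0; exists a.
  by rewrite /sig trmx0 !mul0mx mxE.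
pose r a := cov a a / sig S a a.
have covE a b : a != 0 -> cov a b = r a * sig S a b.
  move=> a0; have h := sig_gt0 a0; have := cov_sig_cross a b.
  rewrite covC (sigC b)// mulrC => hE.
  by apply: (mulIf (lt0r_neq0 h)); rewrite hE /r mulrAC divfK// gt_eqF.
have r_eq a b : a != 0 -> b != 0 -> sig S a b != 0 -> r a = r b.
  move=> a0 b0 ab; apply: (mulIf ab); rewrite -covE// covC covE//.
  by rewrite sigC.
exists (r e) => a b.
have [->|a0] := eqVneq a 0.
  rewrite {1}/sig trmx0 !mul0mx mxE mulr0; apply: cov_orthogonal.
  by rewrite /sig trmx0 !mul0mx mxE.
rewrite covE//; congr (_ * _).
(* When [a] and [e] are orthogonal, their ratios are compared through [a + e], which is orthogonal
   to neither. *)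
have [ae|ae] := eqVneq (sig S a e) 0; last exact: r_eq.
have ha := sig_gt0 a0; have he := sig_gt0 e0.
have s0 : sig S a (a + e) = sig S a a by rewrite sigC// sigDl (sigC e)// ae addr0.
have s1 : sig S (a + e) e = sig S e e by rewrite sigDl ae add0r.
have ae0 : a + e != 0.
  apply/eqP => ae0; move: s1; rewrite ae0 /sig trmx0 !mul0mx mxE => h.
  by move: he; rewrite {1}/sig -h ltxx.
rewrite (r_eq a (a + e))// ?s0 ?gt_eqF//.
by rewrite (r_eq (a + e) e)// s1 gt_eqF.
Qed.

Lemma dev_ae0 a : cov a a = 0 -> {ae P, forall w, dev a w = 0}.
Proof.
move=> caa.
have := Lfun2_integrable_mul (Lfun2_dev a) (Lfun2_dev a).
move=> /Rintegral_norm_eq0; under eq_Rintegral do rewrite -expr2 ger0_norm ?sqr_ge0//.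
by move=> /(_ caa); apply: filterS => w /eqP; rewrite mulf_eq0 orbb => /eqP.
Qed.

End elliptical_moments.

(** * Conditional expectations tested on preimages *)

Lemma measurable_preimage {d d'} {T : measurableType d} {T' : measurableType d'}
    (f : T -> T') (D : set T') :
  measurable_fun setT f -> measurable D -> measurable (f @^-1` D).
Proof. by move=> mf mD; rewrite -[X in measurable X]setTI; exact: mf. Qed.

Section cond_exp.
Context {R : realType} {d dV : measure_display} {T : measurableType d}
  {TV : measurableType dV} {P : probability T R}.
Implicit Types (V : T -> TV) (A B C : T -> R).

Lemma Rintegral_ae_eq A B (D : set T) : measurable D ->
  measurable_fun setT A -> measurable_fun setT B ->
  {ae P, forall w, A w = B w} -> \int[P]_(w in D) A w = \int[P]_(w in D) B w.
Proof.
move=> mD mA mB AB; congr fine; apply: ae_eq_integral => //.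
- exact/measurable_EFinP/(measurable_funS _ _ mA).
- exact/measurable_EFinP/(measurable_funS _ _ mB).
- by apply: filterS AB => w -> _.
Qed.

Lemma cond_exp_eq_Rintegral V A B : cond_exp_eq P V A B ->
  forall D, measurable D ->
  \int[P]_(w in V @^-1` D) A w = \int[P]_(w in V @^-1` D) B w.
Proof.
move=> [C [[_ _ _ CA] [_ _ _ CB]]] D mD.
have VD : g_sigma_algebra_preimage V (V @^-1` D) by exists D; rewrite ?setTI.
by congr fine; rewrite -CA// -CB.
Qed.

(** A function of [V] is measurable for the sigma-algebra of [V], whose events are exactly the
    preimages under [V]; integrability turns equality of real integrals into equality of extended
    ones. *)
Lemma is_cond_exp_comp V A (f : TV -> R) : measurable_fun setT V ->
  measurable_fun setT f ->
  P.-integrable setT (EFin \o A) -> P.-integrable setT (EFin \o (f \o V)) ->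
  (forall D, measurable D ->
    \int[P]_(w in V @^-1` D) f (V w) = \int[P]_(w in V @^-1` D) A w) ->
  is_cond_exp P V A (f \o V).
Proof.
move=> mV mf iA iC CA; split => //.
  by move=> _ B mB; exists (f @^-1` B) => //; exact: measurable_preimage.
move=> _ [D mD <-]; rewrite setTI.
have mVD := measurable_preimage mV mD.
have fin (B : T -> R) : P.-integrable setT (EFin \o B) ->
    (\int[P]_(w in V @^-1` D) (B w)%:E)%E \is a fin_num.
  by move=> iB; apply: integrable_fin_num => //; exact: integrableS iB.
by rewrite -[LHS]fineK ?fin// -[RHS]fineK ?fin//; congr EFin; exact: CA.
Qed.

Lemma Lfun2_of_sqr A : measurable_fun setT A ->
  ('E_P[fun w => (A w ^+ 2)%R] < +oo)%E -> A \in Lfun P 2%:E.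
Proof.
move=> mA; rewrite unlock => A2.
apply/andP; split; rewrite inE//= /finite_norm unlock /Lnorm poweR_lty//.
under eq_integral do rewrite /= powR_mulrn// -normrX ger0_norm ?sqr_ge0//.
exact: A2.
Qed.

End cond_exp.

(** * Bridge functions and conditional expectations in elliptical coordinates *)

Section elliptical_bridge.
Context {R : realType} {d : measure_display} {T : measurableType d}
  {P : probability T R} {n : nat}.
Variables (V : T -> 'cV[R]_n) (mu : 'cV[R]_n) (S : 'M[R]_n) (psi : R -> R[i]).
Hypotheses (V2 : forall i, (fun w => V w i 0) \in Lfun P 2%:E)
  (S_pos : posdef S)
  (V_char : forall t, char_fun P V t = expi (dot t mu) * psi (quad S t)).
Notation e i := (delta_mx i (0 : 'I_1) : 'cV[R]_n).
Notation devV := (dev V mu).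
Notation covV := (@cov R d T P n V mu).

Let integrable_dev a : P.-integrable setT (EFin \o devV a).
Proof. exact: Lfun2_integrable (Lfun2_dev mu V2 a). Qed.

Let measurable_dev a : measurable_fun setT (devV a).
Proof. exact: Lfun2_measurable (Lfun2_dev mu V2 a). Qed.

Lemma dev_delta i w : devV (e i) w = V w i 0 - mu i 0.
Proof. by rewrite /dev !dot_delta. Qed.

Lemma sig_delta_gt0 i : 0 < S i i.
Proof.
rewrite -(sig_delta S); apply: (sig_gt0 S_pos).
apply/eqP => /matrixP /(_ i 0) /eqP; rewrite !mxE !eqxx/= oner_eq0//.
Qed.

Lemma coordinate_regression a i (D : set R) : sig S a (e i) = 0 ->
  measurable D -> \int[P]_(w in (fun w => V w i 0) @^-1` D) devV a w = 0.
Proof.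
move=> ai mD; rewrite -(elliptical_regression V2 S_pos V_char ai mD).
by congr (Rintegral _ _); apply/seteqP; split => w /=; rewrite dot_delta.
Qed.

Lemma cov_neq0 i : covV (e i) (e i) != 0 -> ~ {ae P, forall w, devV (e i) w = 0}.
Proof.
move=> /negP + ae0; apply; apply/eqP; transitivity (\int[P]_w (0 : R)).
  apply: Rintegral_ae_eq => //; first exact: measurable_funM.
  by apply: filterS ae0 => w ->; rewrite mul0r.
by rewrite Rintegral_cst// mul0r.
Qed.

Lemma Rintegral_dev_cst a m (D : set T) : measurable D ->
  \int[P]_(w in D) (m + devV a w) = m * fine (P D) + \int[P]_(w in D) devV a w.
Proof.
move=> mD; rewrite RintegralD//; first by rewrite Rintegral_cst.
- exact: finite_measure_integrable_cst.
- exact: integrableS (integrable_dev a).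
Qed.

Lemma coordinate_expectation i : \int[P]_w V w i 0 = mu i 0.
Proof.
transitivity (\int[P]_w (mu i 0 + devV (e i) w)).
  by apply: eq_Rintegral => w _; rewrite dev_delta; ring.
rewrite Rintegral_dev_cst// (Rintegral_dev V2 S_pos V_char).
by rewrite probability_setT/= mulr1 addr0.
Qed.

Lemma covariance_sig (X Y : T -> R) i j :
  (forall w, V w i 0 = X w) -> (forall w, V w j 0 = Y w) ->
  covariance P X Y = (covV (e i) (e j))%:E.
Proof.
move=> XE YE.
have EX k (F : T -> R) : (forall w, V w k 0 = F w) -> fine 'E_P[F] = mu k 0.
  move=> FE; rewrite -coordinate_expectation unlock.
  by apply: eq_Rintegral => w _; rewrite FE.
rewrite unlock (EX i)// (EX j)// unlock.
have i2 := Lfun2_integrable_mul (Lfun2_dev mu V2 (e i)) (Lfun2_dev mu V2 (e j)).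
rewrite /cov /Rintegral fineK; last exact: integrable_fin_num i2.
by apply: eq_integral => w _; rewrite !dev_delta XE YE.
Qed.

(** Completeness is used twice, through [null]: on [W] minus its mean, to exclude [S w z = 0], and
    on the difference of [h] and the affine candidate. Indices are kept general so that the lemma
    serves [h0] and, with [Z] and [W] exchanged, [g0]. *)
Lemma bridge_affine (Z W : {RV P >-> R}) y z w (h : R -> R) :
  (forall x, V x z 0 = Z x) -> (forall x, V x w 0 = W x) ->
  complete_for W Z -> covV (e w) (e w) != 0 ->
  measurable_fun setT h -> h \o W \in Lfun P 2%:E ->
  (forall D, measurable D -> \int[P]_(x in Z @^-1` D) V x y 0 =
                             \int[P]_(x in Z @^-1` D) h (W x)) ->
  S w z != 0 /\
  {ae P, forall x, h (W x) = mu y 0 + devV ((S y z / S w z) *: e w) x}.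
Proof.
move=> ZE WE compl cw mh h2 Yh.
have regr a : sig S a (e z) = 0 -> forall D, measurable D ->
    \int[P]_(x in Z @^-1` D) devV a x = 0.
  move=> az D mD; rewrite -(coordinate_regression az mD).
  by congr (Rintegral _ _); apply/seteqP; split => x /=; rewrite ZE.
have null (l : R -> R) : measurable_fun setT l -> l \o W \in Lfun P 2%:E ->
    (forall D, measurable D -> \int[P]_(x in Z @^-1` D) l (W x) = 0) ->
    {ae P, forall x, l (W x) = 0}.
  move=> ml l2 l0; apply/(compl l ml l2).
  apply: (@is_cond_exp_comp _ _ _ _ _ _ _ _ (cst 0)) => //.
  - exact: Lfun2_integrable.
  - exact: finite_measure_integrable_cst.
  - move=> D mD; rewrite l0// Rintegral_cst ?mul0r//.
    exact: measurable_preimage.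
have devW a x : devV (a *: e w) x = a * (W x - mu w 0).
  by rewrite devZ dev_delta WE.
have maff a b : measurable_fun setT (fun r : R => a + b * (r - mu w 0)).
  by apply: measurable_funD => //; apply: measurable_funM => //; exact: measurable_funB.
have wz0 : S w z != 0.
  apply/eqP => wz; apply: (cov_neq0 cw).
  have affE x : 0 + 1 * (W x - mu w 0) = devV (e w) x.
    by rewrite add0r -devW scale1r.
  have : {ae P, forall x, 0 + 1 * (W x - mu w 0) = 0}.
    apply: null (maff 0 1) _ _.
      rewrite (_ : _ \o W = devV (e w)); last exact/funext.
      exact: (Lfun2_dev mu V2).
    move=> D mD; under eq_Rintegral do rewrite affE.
    by apply: regr mD; rewrite sig_delta.
  by move=> W0; apply: filterS W0 => x; rewrite affE.
split => //; set b := S y z / S w z.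
have l2 : (fun r => h r - (mu y 0 + b * (r - mu w 0))) \o W \in Lfun P 2%:E.
  rewrite (_ : _ \o W =
      (fun x => (-1) * (1 * devV (b *: e w) x + cst (mu y 0) x) + (h \o W) x)).
    apply: Lfun2_lin h2; apply: Lfun2_lin (Lfun_cst P _ 2).
    exact: (Lfun2_dev mu V2).
  by apply/funext => x; rewrite /= devW; ring.
have ml : measurable_fun setT (fun r => h r - (mu y 0 + b * (r - mu w 0))).
  exact: measurable_funB.
have iaff : P.-integrable setT (EFin \o (fun x => mu y 0 + b * (W x - mu w 0))).
  under eq_fun do rewrite -devW.
  by apply: integrableD_EFin => //; exact: finite_measure_integrable_cst.
have H : {ae P, forall x, h (W x) - (mu y 0 + b * (W x - mu w 0)) = 0}.
  apply: null ml l2 _ => D mD.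
  have mZD : measurable (Z @^-1` D) by exact: measurable_preimage.
  rewrite RintegralB//; last 2 first.
  - exact: integrableS (Lfun2_integrable h2).
  - exact: integrableS iaff.
  rewrite -Yh// -RintegralB//; last 2 first.
  - exact: integrableS (Lfun2_integrable (V2 y)).
  - exact: integrableS iaff.
  (* The slope [b] is the one making [e y - b *: e w] orthogonal to [e z]. *)
  rewrite -(regr (e y + (- b) *: e w) _ _ mD).
    by apply: eq_Rintegral => x _; rewrite devD devW dev_delta; ring.
  by rewrite sigDl sigZl !sig_delta /b mulNr divfK// subrr.
by apply: filterS H => x /eqP; rewrite subr_eq0 devW => /eqP.
Qed.

(** The common version is the regression line on [X] of slope [sig S a (e i) / S i i]: both [a] and
    [b] differ from [r *: e i] by a vector orthogonal to [e i]. *)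
Lemma cond_exp_eq_dev (X : {RV P >-> R}) i (A B : T -> R) m a b :
  (forall w, V w i 0 = X w) ->
  P.-integrable setT (EFin \o A) -> P.-integrable setT (EFin \o B) ->
  {ae P, forall w, A w = m + devV a w} -> {ae P, forall w, B w = m + devV b w} ->
  sig S a (e i) = sig S b (e i) -> cond_exp_eq P X A B.
Proof.
move=> XE iA iB AE BE ab; have Si := sig_delta_gt0 i.
pose r := sig S a (e i) / S i i.
pose f x : R := m + r * (x - mu i 0).
have fX : f \o X = (fun w => m + devV (r *: e i) w).
  by apply/funext => w; rewrite devZ dev_delta XE.
have mf : measurable_fun setT f.
  by apply: measurable_funD => //; apply: measurable_funM => //; exact: measurable_funB.
have icst : P.-integrable setT (EFin \o cst m).
  exact: finite_measure_integrable_cst.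
have iC : P.-integrable setT (EFin \o (f \o X)).
  by rewrite fX; apply: integrableD_EFin.
suff version F c : P.-integrable setT (EFin \o F) ->
    {ae P, forall w, F w = m + devV c w} -> sig S c (e i) = sig S a (e i) ->
    is_cond_exp P X F (f \o X).
  by exists (f \o X); split; [exact: (version _ a)|exact: (version _ b)].
move=> iF FE ca; apply: is_cond_exp_comp => // D mD.
have mXD : measurable (X @^-1` D) by exact: measurable_preimage.
rewrite (@Rintegral_ae_eq _ _ _ P F (fun w => m + devV c w))//; last 2 first.
- exact/measurable_EFinP/(measurable_int _ iF).
- exact: measurable_funD.
rewrite -[LHS]/(\int[P]_(w in _) (f \o X) w) fX !Rintegral_dev_cst//; congr (_ + _).
apply/eqP; rewrite -subr_eq0 -RintegralB//; last 2 first.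
- exact: integrableS (integrable_dev _).
- exact: integrableS (integrable_dev _).
rewrite -(@coordinate_regression (r *: e i + (-1) *: c) i D)//; last first.
  by rewrite sigDl !sigZl sig_delta /r ca divfK ?gt_eqF// mulN1r subrr.
rewrite (_ : (fun w => V w i 0) = X); last exact/funext.
by apply/eqP/eq_Rintegral => w _; rewrite devD [X in _ = _ + X]devZ mulN1r.
Qed.

(** If the slopes differed by [r != 0], the equal conditional expectations would make
    [r * devV (e i)] integrate to 0 on every event of [X], so [X] would be almost surely constant,
    against its nonzero variance. *)
Lemma cond_exp_eq_sig (X : {RV P >-> R}) i (A B : T -> R) m a b :
  (forall w, V w i 0 = X w) -> covV (e i) (e i) != 0 ->
  P.-integrable setT (EFin \o A) -> P.-integrable setT (EFin \o B) ->
  {ae P, forall w, A w = m + devV a w} -> {ae P, forall w, B w = m + devV b w} ->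
  cond_exp_eq P X A B -> sig S a (e i) = sig S b (e i).
Proof.
move=> XE ci iA iB AE BE AB; have Si := sig_delta_gt0 i.
pose r := (sig S a (e i) - sig S b (e i)) / S i i.
have [r0|r0] := eqVneq r 0.
  apply/eqP; rewrite -subr_eq0; move/eqP: r0.
  by rewrite mulf_eq0 invr_eq0 (gt_eqF Si) orbF.
have X0 D : measurable D -> \int[P]_(w in X @^-1` D) devV (e i) w = 0.
  move=> mD; have mXD : measurable (X @^-1` D) by exact: measurable_preimage.
  have := cond_exp_eq_Rintegral AB mD.
  rewrite (@Rintegral_ae_eq _ _ _ P A (fun w => m + devV a w))//; last 2 first.
  - exact/measurable_EFinP/(measurable_int _ iA).
  - exact: measurable_funD.
  rewrite (@Rintegral_ae_eq _ _ _ P B (fun w => m + devV b w))//; last 2 first.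
  - exact/measurable_EFinP/(measurable_int _ iB).
  - exact: measurable_funD.
  rewrite !Rintegral_dev_cst// => /addrI /eqP.
  rewrite -subr_eq0 -RintegralB//; last 2 first.
  - exact: integrableS (integrable_dev _).
  - exact: integrableS (integrable_dev _).
  have regr : \int[P]_(w in X @^-1` D) devV (a + (-1) *: b + (- r) *: e i) w = 0.
    rewrite -(@coordinate_regression (a + (-1) *: b + (- r) *: e i) i D)//.
      by rewrite (_ : (fun w => V w i 0) = X)//; exact/funext.
    by rewrite !sigDl !sigZl sig_delta /r mulN1r mulNr divfK ?gt_eqF//; ring.
  rewrite (_ : \int[P]_(w in _) _ = r * \int[P]_(w in X @^-1` D) devV (e i) w).
    by rewrite mulf_eq0 (negbTE r0) => /eqP.
  apply/eqP; rewrite -subr_eq0 -RintegralZl//; last first.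
    exact: integrableS (integrable_dev _).
  rewrite -RintegralB//; last 2 first.
  - by apply: integrableS (integrableB_EFin (integrable_dev a) (integrable_dev b)).
  - by apply: integrableS (integrableZl_EFin r (integrable_dev (e i))).
  rewrite -[eqbRHS]regr; apply/eqP/eq_Rintegral => w _.
  by rewrite !devD !devZ; ring.
exfalso; apply: (cov_neq0 ci); apply: Rintegral_norm_eq0 => //.
(* [D] is where the deviation is positive; on [D] and on its complement the absolute value is plus
   or minus the deviation, so both integrals vanish by [X0]. *)
pose D := X @^-1` `]mu i 0, +oo[.
have mD : measurable D by apply: measurable_preimage => //; exact: measurable_itv.
have XD w : (w \in D) = (0 < devV (e i) w).
  rewrite dev_delta XE subr_gt0; apply/idP/idP; rewrite inE /D/= in_itv/= andbT//.
have := integrable_norm (integrable_dev (e i)) => inorm.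
rewrite -(setUv D) Rintegral_setU//; last 3 first.
- exact: measurableC.
- by rewrite setUv.
- by apply/disj_set2P; rewrite setICr.
rewrite (@eq_Rintegral _ _ _ P D (devV (e i))); last first.
  by move=> w; rewrite XD => w0; rewrite gtr0_norm.
rewrite (@eq_Rintegral _ _ _ P (~` D) (fun w => (-1) * devV (e i) w)); last first.
  by move=> w; rewrite in_setC XD -leNgt => w0; rewrite ler0_norm// mulN1r.
rewrite RintegralZl//; last 2 first.
- exact: measurableC.
- by apply: integrableS (integrable_dev _) => //; exact: measurableC.
have mI : measurable (`]mu i 0, +oo[%classic : set R) by exact: measurable_itv.
by rewrite /D preimage_setC !X0 ?mulr0 ?addr0//; exact: measurableC.
Qed.

End elliptical_bridge.

(** * Linearity of the bridges and equivalence of the tetrads *)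

Theorem proposition2 (R : realType) (d dU : measure_display)
    (T : measurableType d) (TU : measurableType dU) (P : probability T R)
    (X Y Z W : {RV P >-> R}) (U : {RV P >-> TU}) (h0 g0 : R -> R)
    (X2 : (X : T -> R) \in Lfun P 2%:E) (Y2 : (Y : T -> R) \in Lfun P 2%:E)
    (Z2 : (Z : T -> R) \in Lfun P 2%:E) (W2 : (W : T -> R) \in Lfun P 2%:E)
    (A1 : confounding_bridge Y Z W U h0 g0)
    (A2 : completeness Z W)
    (XYZW_elliptical : elliptical P (rvec4 X Y Z W)) :
  [/\ as_linear g0 Z,
      as_linear h0 W &
      generalized_tetrad X Y Z W h0 g0 <-> classical_tetrad X Y Z W].
Proof.
have [mu [S [psi [S_pos V_char]]]] := XYZW_elliptical.
pose x : 'I_4 := inord 0; pose y : 'I_4 := inord 1.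
pose z : 'I_4 := inord 2; pose w : 'I_4 := inord 3.
set V := rvec4 X Y Z W in V_char.
have XE t : V t x 0 = X t by rewrite mxE (tnth_nth 0) inordK.
have YE t : V t y 0 = Y t by rewrite mxE (tnth_nth 0) inordK.
have ZE t : V t z 0 = Z t by rewrite mxE (tnth_nth 0) inordK.
have WE t : V t w 0 = W t by rewrite mxE (tnth_nth 0) inordK.
have V2 i : (fun t => V t i 0) \in Lfun P 2%:E.
  have iE : i = inord i by apply/val_inj; rewrite /= inordK.
  have : (i < 4)%N by [].
  case: (val i) iE => [|[|[|[|m]]]] -> // _.
  - by rewrite (_ : (fun _ => _) = X)//; apply/funext.
  - by rewrite (_ : (fun _ => _) = Y)//; apply/funext.
  - by rewrite (_ : (fun _ => _) = Z)//; apply/funext.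
  - by rewrite (_ : (fun _ => _) = W)//; apply/funext.
have [[mh h_sqr Yh] [mg g_sqr Yg]] := A1.
have [complW complZ] := A2.
have h2 : h0 \o W \in Lfun P 2%:E.
  by apply: Lfun2_of_sqr => //; exact: measurableT_comp.
have g2 : g0 \o Z \in Lfun P 2%:E.
  by apply: Lfun2_of_sqr => //; exact: measurableT_comp.
(* The tower property: an event of [Z] is an event of the pair [(U, Z)] that leaves [U] free. *)
have YhZ (D : set R) : measurable D -> \int[P]_(t in Z @^-1` D) V t y 0 =
    \int[P]_(t in Z @^-1` D) h0 (W t).
  move=> mD; under eq_Rintegral do rewrite YE.
  have := cond_exp_eq_Rintegral Yh (measurableX measurableT mD).
  by rewrite (_ : _ @^-1` _ = Z @^-1` D)//; apply/seteqP; split => t //= [].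
have YgW (D : set R) : measurable D -> \int[P]_(t in W @^-1` D) V t y 0 =
    \int[P]_(t in W @^-1` D) g0 (Z t).
  move=> mD; under eq_Rintegral do rewrite YE.
  have := cond_exp_eq_Rintegral Yg (measurableX measurableT mD).
  by rewrite (_ : _ @^-1` _ = W @^-1` D)//; apply/seteqP; split => t //= [].
have [k covE] := cov_proportional V2 S_pos V_char.
have S_sym i j : S i j = S j i by rewrite -[in LHS]S_pos.1 mxE.
have covarE F G i j : (forall t, V t i 0 = F t) -> (forall t, V t j 0 = G t) ->
    covariance P F G = (k * S i j)%:E.
  move=> FE GE; rewrite (covariance_sig V2 S_pos V_char FE GE) covE.
  by rewrite sig_delta.
(* The factor [k ^+ 2] is kept so that the equivalence also covers [k = 0]. *)
have classicalE : classical_tetrad X Y Z W <->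
    k ^+ 2 * (S x y * S z w) = k ^+ 2 * (S x z * S y w) /\
    k ^+ 2 * (S x z * S y w) = k ^+ 2 * (S x w * S y z).
  have cE i j i' j' : (k * S i j) * (k * S i' j') = k ^+ 2 * (S i j * S i' j').
    by ring.
  rewrite /classical_tetrad (covarE _ _ _ _ XE YE) (covarE _ _ _ _ ZE WE).
  rewrite (covarE _ _ _ _ XE ZE) (covarE _ _ _ _ YE WE).
  rewrite (covarE _ _ _ _ XE WE) (covarE _ _ _ _ YE ZE) -!EFinM !cE.
  by split=> [[[-> ] [->]]|[-> ->]].
have iY : P.-integrable setT (EFin \o Y) by exact: Lfun2_integrable.
have ih := Lfun2_integrable h2; have ig := Lfun2_integrable g2.
have [kz|kn0] := eqVneq k 0.
  have dev0 i : {ae P, forall t, dev V mu (delta_mx i 0) t = 0}.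
    by apply: (dev_ae0 V2); rewrite covE kz mul0r.
  have const i (F : {RV P >-> R}) (f : R -> R) : (forall t, V t i 0 = F t) ->
      {ae P, forall t, f (F t) = f (mu i 0)}.
    move=> FE; apply: filterS (dev0 i) => t /eqP.
    by rewrite dev_delta FE subr_eq0 => /eqP ->.
  have mean i (F : {RV P >-> R}) (f : R -> R) : (forall t, V t i 0 = F t) ->
      measurable_fun setT f -> \int[P]_t f (F t) = f (mu i 0).
    move=> FE mf.
    rewrite (@Rintegral_ae_eq _ _ _ P _ (fun=> f (mu i 0)))//; last 2 first.
    - exact: measurableT_comp.
    - exact: const.
    rewrite Rintegral_cst// -[RHS]mulr1; congr (_ * _).
    by rewrite -[RHS]/(fine 1%E); congr fine; exact: probability_setT.
  have muy := coordinate_expectation V2 S_pos V_char y.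
  (* The bridge identity over the whole space equates the means of [h0 (W)] and [Y], and here [W] is
     almost surely [mu w 0]. *)
  have hmu : h0 (mu w 0) = mu y 0.
    by rewrite -(mean w W)// -muy; have := YhZ setT measurableT; rewrite preimage_setT.
  have gmu : g0 (mu z 0) = mu y 0.
    by rewrite -(mean z Z)// -muy; have := YgW setT measurableT; rewrite preimage_setT.
  split.
  - exists (g0 (mu z 0)), 0; apply: filterS (const z Z g0 ZE) => t ->.
    by rewrite mul0r addr0.
  - exists (h0 (mu w 0)), 0; apply: filterS (const w W h0 WE) => t ->.
    by rewrite mul0r addr0.
  rewrite classicalE kz expr0n !mul0r; split=> // _.
  (* Writing the constants with the direction 0 brings them into the form required by
     [cond_exp_eq_dev], with equal slopes. *)
  have d0 t : dev V mu 0 t = 0.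
    by rewrite -[0](scale0r (0 : 'cV[R]_4)) devZ mul0r.
  have aY : {ae P, forall t, Y t = mu y 0 + dev V mu 0 t}.
    by apply: filterS (const y Y id YE) => t /= ->; rewrite d0 addr0.
  have ah : {ae P, forall t, (h0 \o W) t = mu y 0 + dev V mu 0 t}.
    by apply: filterS (const w W h0 WE) => t /= ->; rewrite hmu d0 addr0.
  have ag : {ae P, forall t, (g0 \o Z) t = mu y 0 + dev V mu 0 t}.
    by apply: filterS (const z Z g0 ZE) => t /= ->; rewrite gmu d0 addr0.
  split; first exact: (cond_exp_eq_dev V2 S_pos V_char XE iY ih aY ah).
  exact: (cond_exp_eq_dev V2 S_pos V_char XE ih ig ah ag).
have cov_n0 i : @cov _ _ _ P _ V mu (delta_mx i 0) (delta_mx i 0) != 0.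
  by rewrite covE sig_delta mulf_neq0// gt_eqF// (sig_delta_gt0 S_pos).
have [wz ah] := bridge_affine V2 S_pos V_char ZE WE complW (cov_n0 w) mh h2 YhZ.
have [zw ag] := bridge_affine V2 S_pos V_char WE ZE complZ (cov_n0 z) mg g2 YgW.
split.
- exists (mu y 0 - S y w / S z w * mu z 0), (S y w / S z w).
  by apply: filterS ag => t ->; rewrite devZ dev_delta ZE; ring.
- exists (mu y 0 - S y z / S w z * mu w 0), (S y z / S w z).
  by apply: filterS ah => t ->; rewrite devZ dev_delta WE; ring.
have aY : {ae P, forall t, Y t = mu y 0 + dev V mu (delta_mx y 0) t}.
  by apply: aeW => t; rewrite dev_delta YE; ring.
have tetrad F G a b : P.-integrable setT (EFin \o F) ->
    P.-integrable setT (EFin \o G) ->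
    {ae P, forall t, F t = mu y 0 + dev V mu a t} ->
    {ae P, forall t, G t = mu y 0 + dev V mu b t} ->
    cond_exp_eq P X F G <-> sig S a (delta_mx x 0) = sig S b (delta_mx x 0).
  move=> iF iG FE GE; split.
    exact: (cond_exp_eq_sig V2 S_pos V_char XE (cov_n0 x) iF iG FE GE).
  exact: (cond_exp_eq_dev V2 S_pos V_char XE iF iG FE GE).
(* The generalized tetrad becomes [S y x = S y z / S w z * S w x = S y w / S z w * S z x]. Clearing
   the denominator [S z w] and cancelling [k ^+ 2] matches it with the classical one. *)
rewrite classicalE /generalized_tetrad (tetrad _ _ _ _ iY ih aY ah).
rewrite (tetrad _ _ _ _ ih ig ah ag) !sigZl !sig_delta.
have k2 : k ^+ 2 != 0 by rewrite expf_neq0.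
rewrite (S_sym y x) (S_sym w x) (S_sym z x) (S_sym w z).
split=> [[E0 E]|[/(mulfI k2) E1 /(mulfI k2) E2]].
  have E' : S x z * S y w = S x w * S y z.
    apply: (mulIf (invr_neq0 zw)).
    by rewrite -mulrA mulrC -E mulrC mulrA.
  split; congr (_ * _) => //.
  by rewrite E0 (mulrAC _ _ (S z w)) divfK// E' mulrC.
split; apply: (mulIf zw); rewrite (mulrAC _ (S x w)) divfK//.
  by rewrite E1 E2 mulrC.
by rewrite (mulrAC _ (S x z)) divfK// mulrC -E2 mulrC.
Qed.
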